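(* Let $m,n\geq 3$ be integers and $D=\overrightarrow{C}_m[\overrightarrow{C}_n]$. For any harmonious coloring of $D$ with $k$ colors, \[k\geq \min\{\max\{f_n(x),g_n(x)\}: x\in\mathbb{N},\ x\geq 1\},\] where $f_n(x)=\lceil mn/x\rceil$ and $g_n(x)=x(n+1)+1$.
   Context: $\overrightarrow{C}_m$ is the directed cycle with vertex set $\mathbb{Z}_m$ and arcs $j\to j+1$. The lexicographic product $D[H]$ has vertex set $V(D)\times V(H)$, with an arc from $(u,a)$ to $(v,b)$ iff $uv\in A(D)$, or $u=v$ and $ab\in A(H)$. A coloring with $k$ colors is a surjection $V(D)\to[k]$ that is proper (each color class spans no arc); it is harmonious if for every ordered pair $(i,j)$ of distinct colors there is at most one arc from a vertex colored $i$ to a vertex colored $j$. *)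

(* Defs.v *)
From mathcomp Require Import all_boot all_order all_algebra.
From mathcomp Require Import boolp.

Set Implicit Arguments.
Unset Strict Implicit.
Unset Printing Implicit Defensive.

Import GRing.Theory.

(* A finite digraph is given by its arc relation on a finType of vertices. *)

(* Meant for m >= 2: in mathcomp, 'Z_0 and 'Z_1 are both Z/2. *)
Definition dcycle (m : nat) : rel 'Z_m := fun i j => j == (i + 1)%R.

Definition lexprod (V W : finType) (D : rel V) (H : rel W) : rel (V * W) :=
  fun p q => D p.1 q.1 || ((p.1 == q.1) && H p.2 q.2).

Section Coloring.
Variables (V : finType) (D : rel V) (k : nat) (c : V -> 'I_k).

Definition proper_coloring : Prop :=
  (forall i : 'I_k, exists v, c v = i) /\
  (forall u v, D u v -> c u <> c v).

Definition arcs_between (i j : 'I_k) : {set V * V} :=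
  [set a | [&& D a.1 a.2, c a.1 == i & c a.2 == j]].

Definition harmonious_coloring : Prop :=
  proper_coloring /\
  (forall i j : 'I_k, i != j -> #|arcs_between i j| <= 1).
End Coloring.

Lemma posvalues_nonempty (F : nat -> nat) :
  exists v, `[< exists2 x, 1 <= x & v = F x >].
Proof. by exists (F 1); apply/asboolP; exists 1. Qed.

(* min {F x : x in nat, x >= 1} *)
Definition minpos (F : nat -> nat) : nat := ex_minn (posvalues_nonempty F).

(* The ceiling is an int, nonnegative here, so absz is a mere cast to nat. *)
Definition fn (m n x : nat) : nat :=
  absz (Num.ceil ((m * n)%N%:R / x%:R : rat)%R).

Definition gn (n x : nat) : nat := x * (n + 1) + 1.

(* Main.v *)
Require Import Defs.
From mathcomp Require Import all_boot all_order all_algebra.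
From mathcomp Require Import boolp.

Set Implicit Arguments.
Unset Strict Implicit.
Unset Printing Implicit Defensive.

Import Order.POrderTheory GRing.Theory Num.Theory.

(** Let [x] be the size of a largest color class. The [k] classes cover the
    [m * n] vertices, so [m * n <= k * x]. Every vertex has [n + 1]
    out-neighbors, and the [x * (n + 1)] arcs leaving a largest class end in
    pairwise distinct colors, all different from its own, so
    [x * (n + 1) <= k - 1]. Hence the minimum is at most its value at [x]. *)

Lemma minpos_le (F : nat -> nat) (x : nat) : 0 < x -> minpos F <= F x.
Proof.
move=> x_gt0; rewrite /minpos; case: ex_minnP => v _; apply.
by apply/asboolP; exists x.
Qed.

Lemma leq_fnLR (m n x k : nat) : 0 < x -> (fn m n x <= k) = (m * n <= k * x).
Proof.
move=> x_gt0.
have xQ_gt0 : (0 < x%:R :> rat)%R by rewrite ltr0n.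
have ceil_ge0 : (0 <= Num.ceil ((m * n)%N%:R / x%:R : rat))%R.
  by rewrite ceil_ge0 (lt_le_trans (ltrN10 _)) ?divr_ge0 ?ler0n.
rewrite /fn -lez_nat gez0_abs // ceil_le_int ler_pdivrMr //.
by rewrite -pmulrn -natrM ler_nat.
Qed.

Lemma exists_large_fiber (T I : finType) (f : T -> I) : 0 < #|I| ->
  exists i, #|T| <= #|I| * #|f @^-1: [set i]|.
Proof.
move=> I_gt0; have [i max_i] := eq_bigmax (fun i => #|f @^-1: [set i]|) I_gt0.
exists i; rewrite -max_i -sum_nat_const -sum1_card (partition_big f predT) //=.
apply: leq_sum => j _; apply: leq_trans (leq_bigmax j).
by rewrite sum1_card; apply/eq_leq/eq_card => v; rewrite !inE.
Qed.

Definition outdegree (V : finType) (D : rel V) (u : V) : nat := #|D u|.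

Lemma outdegree_lexprod (V W : finType) (D : rel V) (H : rel W) (p : V * W) :
  irreflexive D ->
  outdegree (lexprod D H) p = outdegree D p.1 * #|W| + outdegree H p.2.
Proof.
case: p => u a irrD; rewrite /outdegree /=.
pose across := [predX D u & W]; pose inside := [predX pred1 u & H a].
have across_inside0 : #|[predI across & inside]| = 0.
  apply: eq_card0 => -[v b]; rewrite !inE /=.
  by have [->|_] := eqVneq v u; rewrite ?andbF // unfold_in irrD.
have -> : #|lexprod D H (u, a)| = #|[predU across & inside]|.
  apply: eq_card => -[v b]; rewrite !inE /= andbT unfold_in /lexprod /=.
  by rewrite (eq_sym u v).
by rewrite -[LHS]addn0 -across_inside0 cardUI !cardX card1 mul1n.
Qed.

Lemma dcycle_irreflexive (m : nat) : irreflexive (@dcycle m).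
Proof.
move=> u; rewrite /dcycle -[X in X == _]addr0 (inj_eq (addrI u)).
by rewrite eq_sym oner_eq0.
Qed.

Lemma outdegree_dcycle (m : nat) (u : 'Z_m) : outdegree (@dcycle m) u = 1.
Proof. exact: card1. Qed.

Section ColorClass.
Variables (V : finType) (D : rel V) (k : nat) (c : V -> 'I_k).

Definition color_class (i : 'I_k) : {set V} := c @^-1: [set i].

Lemma sum_outdegree_color_class (i : 'I_k) : proper_coloring D c ->
  \sum_(u in color_class i) outdegree D u =
    \sum_(j | j != i) #|arcs_between D c i j|.
Proof.
move=> [_ properD].
under eq_bigr => u _ do rewrite /outdegree -sum1_card.
rewrite pair_big_dep (partition_big (fun a => c a.2) (predC1 i)) /=.
  apply: eq_bigr => j _; rewrite sum1_card; apply: eq_card => -[u v].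
  by rewrite !inE unfold_in /= !inE andbA (andbC (D u v)).
move=> [u v]; rewrite !inE /= => /andP[/eqP <- Duv].
by apply/eqP => /esym; apply: properD.
Qed.

Lemma harmonious_sum_outdegree (i : 'I_k) : harmonious_coloring D c ->
  \sum_(u in color_class i) outdegree D u < k.
Proof.
move=> [properD arcs_le1]; rewrite sum_outdegree_color_class //.
apply: (@leq_ltn_trans #|predC1 i|).
  by rewrite -sum1_card; apply: leq_sum => j; rewrite eq_sym => /arcs_le1.
by rewrite cardC1 card_ord ltn_predL (leq_ltn_trans _ (ltn_ord i)).
Qed.

Lemma harmonious_large_color_class (d : nat) : 0 < #|V| ->
    (forall u, d <= outdegree D u) -> harmonious_coloring D c ->
  exists i, [/\ 0 < #|color_class i|, #|V| <= k * #|color_class i|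
              & #|color_class i| * d < k].
Proof.
move=> V_gt0 outdeg_ge harmD; have /card_gt0P[v _] := V_gt0.
have [|i] := @exists_large_fiber _ _ c.
  by rewrite card_ord (leq_ltn_trans _ (ltn_ord (c v))).
rewrite card_ord => V_le; exists i; split => //.
  by have := leq_trans V_gt0 V_le; rewrite muln_gt0 => /andP[].
apply: leq_ltn_trans (harmonious_sum_outdegree i harmD).
by rewrite -sum_nat_const; apply: leq_sum => u _; apply: outdeg_ge.
Qed.

End ColorClass.

Theorem theorem10 (m n : nat) (hm : 3 <= m) (hn : 3 <= n)
    (k : nat) (c : 'Z_m * 'Z_n -> 'I_k) :
  harmonious_coloring (lexprod (@dcycle m) (@dcycle n)) c ->
  minpos (fun x => maxn (fn m n x) (gn n x)) <= k.
Proof.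
move=> harmc.
have card_Zm : #|'Z_m| = m by rewrite card_ord Zp_cast ?(ltnW hm).
have card_Zn : #|'Z_n| = n by rewrite card_ord Zp_cast ?(ltnW hn).
have card_vertices : #|{: 'Z_m * 'Z_n}| = m * n.
  by rewrite card_prod card_Zm card_Zn.
have outdeg p : outdegree (lexprod (@dcycle m) (@dcycle n)) p = n + 1.
  rewrite outdegree_lexprod; last exact: dcycle_irreflexive.
  by rewrite !outdegree_dcycle card_Zn mul1n.
have [||i [class_gt0]] := harmonious_large_color_class (d := n + 1) _ _ harmc.
- by rewrite card_vertices muln_gt0 !(leq_trans _ hm, leq_trans _ hn).
- by move=> p; rewrite outdeg.
rewrite card_vertices => mn_le arcs_lt.
apply: leq_trans (minpos_le _ class_gt0) _.
by rewrite geq_max leq_fnLR // mn_le /gn addn1 arcs_lt.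
Qed.
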